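(* Let $d$ and $n$ be nonnegative integers, let $(T_i)_{i\in\{0,\dots,d-1\}}$ be a $d$-tuple of pairwise disjoint chains, let $P$ be a subposet of $\prod_{i=0}^{d-1} T_i$, and let $(M_j)_{j\in\{0,\dots,n-1\}}$ be an $n$-tuple of pairwise disjoint subsets of $\bigcup_{i=0}^{d-1} T_i$ such that: for every comparable pair of elements $p\leq p'$ in $P$ and every $j\in\{0,\dots,n-1\}$, there exists $i\in\{0,\dots,d-1\}$ such that the $i$-th coordinates of $p$ and $p'$ are equal and their common value is a member of $M_j$. Then for every $n$-tuple of chains $(C_j)_{j\in\{0,\dots,n-1\}}$ we have $$\dim\Big(P\times\prod_{j=0}^{n-1} C_j\Big)\ \leq\ d.$$
   Context: All posets (in particular all chains) are nonempty. The product of posets carries the componentwise order: $(x_k)\leq(y_k)$ iff $x_k\leq y_k$ for all $k$; the product of the empty family is a one-point poset. The dimension $\dim(Q)$ of a poset $Q$ is the least cardinal $\kappa$ such that $Q$ admits an order-embedding (a map $f$ with $x\leq y\iff f(x)\leq f(y)$) into a product of $\kappa$ chains; equivalently, the least $\kappa$ such that the order of $Q$ is the intersection of $\kappa$ total orders on the underlying set of $Q$. *)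

(* Defs.v *)
From HB Require Import structures.
From mathcomp Require Import all_boot all_order.
From mathcomp Require Import boolp classical_sets cardinality.

Set Implicit Arguments.
Unset Strict Implicit.
Unset Printing Implicit Defensive.

Import Order.TTheory.
Local Open Scope order_scope.
Local Open Scope classical_set_scope.
Local Open Scope card_scope.

(* The library orders non-dependent functions only (FunOrder), whereas a
   product of posets over an arbitrary, possibly infinite or empty, index type
   needs dependent ones. *)
Definition prod_poset (disp : Order.disp_t) (K : Type)
  (T : K -> porderType disp) : Type := forall k, T k.

Section ProdPOrder.
Variables (disp : Order.disp_t) (K : Type) (T : K -> porderType disp).
Implicit Types x y z : prod_poset T.

HB.instance Definition _ := gen_eqMixin (prod_poset T).
HB.instance Definition _ := gen_choiceMixin (prod_poset T).

Definition prod_le x y : bool := `[< forall k, x k <= y k >].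

Fact prod_le_refl : reflexive prod_le.
Proof. by move=> x; apply/asboolP. Qed.

Fact prod_le_anti : antisymmetric prod_le.
Proof.
move=> x y /andP[/asboolP xy /asboolP yx]; apply: functional_extensionality_dep.
by move=> k; apply/le_anti; rewrite xy yx.
Qed.

Fact prod_le_trans : transitive prod_le.
Proof.
move=> y x z /asboolP xy /asboolP yz; apply/asboolP => k.
exact: le_trans (xy k) (yz k).
Qed.

HB.instance Definition _ := Order.Le_isPOrder.Build disp (prod_poset T)
  prod_le_refl prod_le_anti prod_le_trans.

Lemma prod_leP x y : reflect (forall k, x k <= y k) (x <= y).
Proof. exact: asboolP. Qed.

End ProdPOrder.

Definition subposet (disp : Order.disp_t) (T : porderType disp)
  (P : set T) : Type := set_type P.

HB.instance Definition _ (disp : Order.disp_t) (T : porderType disp)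
  (P : set T) := SubChoice.on (subposet P).
HB.instance Definition _ (disp : Order.disp_t) (T : porderType disp)
  (P : set T) := [SubChoice_isSubPOrder of subposet P by <: with disp].

(* Cardinals are represented by index types, compared through `#<=`. *)
Definition embeds_in_chains (disp : Order.disp_t) (Q : porderType disp)
    (K : Type) : Prop :=
  exists (disp' : Order.disp_t) (C : K -> orderType disp'),
    (forall k, inhabited (C k)) /\
    exists f : Q -> prod_poset C, {mono f : x y / x <= y}.

(* The cardinality of K is the dimension of Q. *)
Definition is_dim (disp : Order.disp_t) (Q : porderType disp) (K : Type) :
    Prop :=
  embeds_in_chains Q K /\
  forall J : Type, embeds_in_chains Q J -> [set: K] #<= [set: J].

Definition dim_le (disp : Order.disp_t) (Q : porderType disp) (I : Type) :
    Prop :=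
  exists K : Type, is_dim Q K /\ [set: K] #<= [set: I].

(* Main.v *)
(** Lexicographically replace each point [t] of [T i] that lies in some [M j]
    (for a unique [j], by disjointness) by a copy of [C j], and send [(p, c)] to
    the family whose [i]-th coordinate is [p i], refined by [c j] when [p i] lies
    in [M j].  When [p <= p'], each [j] has a coordinate at which [p] and [p']
    agree in a point of [M j], and there the order compares [c j] with [c' j];
    hence this map into [d] chains is an order-embedding. *)
Require Import Defs.
From mathcomp Require Import all_boot all_order.
From mathcomp Require Import boolp classical_sets cardinality functions.
Import Order.TTheory.
Local Open Scope order_scope.
Local Open Scope classical_set_scope.

(** Reindexing along the surjection [g] only repeats chains; every index [j] is still tested, at
    [h j]. *)
Lemma embeds_in_chains_surj (disp : Order.disp_t) (Q : porderType disp)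
    (J K : Type) (g : K -> J) (h : J -> K) :
  cancel h g -> embeds_in_chains Q J -> embeds_in_chains Q K.
Proof.
move=> hK [disp' [C [C0 [f f_mono]]]].
exists disp', (fun k => C (g k)); split=> [k|]; first exact: C0.
exists (fun x k => f x (g k)) => x y; rewrite -f_mono.
apply/prod_leP/prod_leP => le_xy j; last exact: le_xy.
by have := le_xy (h j); rewrite hK.
Qed.

Lemma embeds_in_chains_ord (disp : Order.disp_t) (Q : porderType disp)
    (J : Type) (k : nat) :
  ([set: J] #= [set: 'I_k])%card ->
  embeds_in_chains Q J -> embeds_in_chains Q 'I_k.
Proof.
move=> /card_bijP[f [g fK _]].
apply: (embeds_in_chains_surj _ _ _ _ (fun k => val (g (to_setT k)))
          (fun j => val (f (to_setT j)))) => j.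
by rewrite (_ : to_setT (val _) = f (to_setT j)) ?fK //; exact: val_inj.
Qed.

(** A least [m] exists among the finite sizes that work; an infinite index type dominates [m]
    anyway, so ['I_m] is minimal among all types. *)
Lemma embeds_in_chains_dim_le (disp : Order.disp_t) (Q : porderType disp)
    (d : nat) :
  embeds_in_chains Q 'I_d -> dim_le Q 'I_d.
Proof.
move=> Qd; have exQ : exists k, `[< embeds_in_chains Q 'I_k >].
  by exists d; apply/asboolP.
have cardI k : ([set: 'I_k] #= `I_k)%card by exact/card_esym/card_II.
case: (ex_minnP exQ) => m /asboolP Qm m_min.
exists 'I_m; split; last first.
  rewrite (card_le_eql (cardI m)) (card_le_eqr (cardI d)) card_le_II m_min //.
  exact/asboolP.
split=> // J QJ; rewrite (card_le_eql (cardI m)).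
have [/finite_setP[k Jk]|/infiniteP] := pselect (finite_set [set: J]).
  rewrite (card_le_eqr Jk) card_le_II m_min //; apply/asboolP.
  by apply: embeds_in_chains_ord QJ; exact: card_eq_trans Jk card_II.
by apply: card_le_trans; exact: card_leT.
Qed.

Section Refinement.
Variables (U : Type) (n : nat) (M : 'I_n -> set U).
Variables (dC : Order.disp_t) (C : 'I_n -> orderType dC).

(* A sequence has length at most one here: it is empty outside the union of the
   [M j]. *)
Definition refine (u : U) (c : prod_poset C) : seqlexi {j : 'I_n & C j} :=
  if pselect (exists j, M j u) is left uM
  then [:: Tagged (fun j => C j) (c (projT1 (cid uM)))] else [::].

Lemma refine_mono (u : U) (c c' : prod_poset C) :
  c <= c' -> refine u c <= refine u c'.
Proof.
move=> /prod_leP cc'; rewrite /refine; case: pselect => // uM.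
by rewrite lexi_cons lexx implybT leEsig /= lexx tagged_asE /= cc'.
Qed.

Lemma refine_le (j : 'I_n) (u : U) (c c' : prod_poset C) :
  trivIset [set: 'I_n] M -> M j u -> refine u c <= refine u c' -> c j <= c' j.
Proof.
move=> M_disjoint Mju; rewrite /refine; case: pselect => [uM|[]]; last by exists j.
(* The index chosen by [cid] is some [j'] with [M j' u]; disjointness forces it to be [j]. *)
have -> : projT1 (cid uM) = j.
  by apply: M_disjoint => //; exists u; split=> //; exact: projT2 (cid uM).
by rewrite lexi_cons leEsig /= lexx tagged_asE => /andP[].
Qed.

End Refinement.

Arguments refine {U n} M {dC C} u c.
Arguments refine_mono {U n M dC C} u {c c'}.
Arguments refine_le {U n M dC C j u c c'}.

(* The union of the pairwise disjoint chains T i is the sigma type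
   {i : 'I_d & T i}. *)
Theorem theorem2p1 (d n : nat)
    (dT : Order.disp_t) (T : 'I_d -> orderType dT)
    (T_nonempty : forall i, inhabited (T i))
    (P : set (prod_poset T)) (P_nonempty : P !=set0)
    (M : 'I_n -> set {i : 'I_d & T i})
    (M_disjoint : trivIset [set: 'I_n] M)
    (M_comparable : forall p p' : prod_poset T, P p -> P p' -> p <= p' ->
       forall j : 'I_n, exists i : 'I_d,
         p i = p' i /\ M j (existT (fun i => T i : Type) i (p i)))
    (dC : Order.disp_t) (C : 'I_n -> orderType dC)
    (C_nonempty : forall j, inhabited (C j)) :
  dim_le (subposet P *p prod_poset C)%type 'I_d.
Proof.
apply: embeds_in_chains_dim_le.
pose pt (p : prod_poset T) i := existT (fun i => T i : Type) i (p i).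
exists _, (fun i => (T i *l seqlexi {j : 'I_n & C j})%type); split=> [i|].
  (* The empty sequence is available whether or not [t] lies in some [M j]. *)
  by have [t] := T_nonempty i; exists; exact: (t, [::]).
exists (fun x i => (val x.1 i, refine M (pt (val x.1) i) x.2)).
move=> [[p pP] c] [[p' p'P] c']; rewrite leEprod /=.
apply/prod_leP/andP => /= [xx'|[/prod_leP pp' cc'] i].
  (* Leading components give [p <= p'], which is what makes [M_comparable] applicable. *)
  have pp' : p <= p'.
    by apply/prod_leP => i; have := xx' i; rewrite leEprodlexi => /andP[].
  split=> //; apply/prod_leP => j.
  have [i [pi Mj]] := M_comparable p p' (set_mem pP) (set_mem p'P) pp' j.
  apply: (refine_le M_disjoint Mj).
  by have := xx' i; rewrite leEprodlexi /pt /= pi lexx.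
(* The refinements are compared only where [p i] and [p' i] coincide, hence at one common point. *)
rewrite leEprodlexi /= pp' /=; apply/implyP => p'p.
have pE : p i = p' i by apply/le_anti/andP; split; [exact: pp'|].
by rewrite /pt /= pE; exact: refine_mono.
Qed.
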